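(* For real $a$ let $M_a(q)$ be the one-step amplification matrix of the five-subflow palindromic splitting, with diagonal entry $A_a(q)=1-\frac{q^2}{2}+\frac{g_2(a)}{2}q^4$, $g_2(a)=\frac{a(1-2a)}{2}$, and let $$Q(a)=\sup\{Q\ge 0:\ |A_a(q)|\le 1\ \text{for all } 0\le q\le Q\}$$ be the length of the contiguous spectral stability interval containing $q=0$. Then, among all $a\in\mathbb{R}$, the unique coefficient maximizing the contiguous spectral stability interval (i.e. maximizing $Q(a)$) is $$a=\tfrac14,\qquad 1-2a=\tfrac12 .$$ For this choice, $|A_{1/4}(q)|\le 1$ for $0\le q^2\le 16$. With the fourth-order staggered stencil, the corresponding $d$-dimensional CFL threshold is $$s_{\rm stab}^*=\frac{12}{7\sqrt d},$$ and the practical stability condition is $s<s_{\rm stab}^*$.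
   Context: Setting. For a nonzero transverse Fourier mode, the energy-scaled, spatially semidiscretized, constant-coefficient lossless Maxwell system (wave speed $\nu>0$) reduces to $\frac{d}{dt}(h,e)^{T}=\nu K_h\begin{bmatrix}0&-1\\1&0\end{bmatrix}(h,e)^{T}$. It is split into the electric part $C=\nu K_h\begin{bmatrix}0&0\\1&0\end{bmatrix}$ and the magnetic part $D=\nu K_h\begin{bmatrix}0&-1\\0&0\end{bmatrix}$. With time step $\Delta t>0$ and $q=\nu\Delta t K_h$, the one-step matrix of the palindromic family with parameter $a$ is $$M_a(q)=e^{a\Delta t C}e^{\frac12\Delta t D}e^{(1-2a)\Delta t C}e^{\frac12\Delta t D}e^{a\Delta t C}.$$ It has determinant $1$ and both diagonal entries equal to $A_a(q)=1-\frac{q^2}{2}+\frac{g_2(a)}{2}q^4$, $g_2(a)=a(1-2a)/2$, so its characteristic polynomial is $\lambda^2-2A_a(q)\lambda+1$. Spectral (von Neumann) stability at $q$ means $|A_a(q)|\le 1$. Fourth-order staggered stencil. In $d\ge 1$ spatial dimensions with equal mesh width $\Delta x$ in every active direction, each first derivative is replaced by $\frac{27(u_{i+1/2}-u_{i-1/2})-(u_{i+3/2}-u_{i-3/2})}{24\Delta x}$. For a wave vector $\kappa=(\kappa_1,\dots,\kappa_d)\in\mathbb{R}^d$, set $$\eta_\xi=\frac{27\sin(\kappa_\xi\Delta x/2)-\sin(3\kappa_\xi\Delta x/2)}{12}\in\left[-\tfrac73,\tfrac73\right],\qquad K_h^2=\frac1{\Delta x^2}\sum_{\xi=1}^d\eta_\xi^2,\qquad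 s=\frac{\nu\Delta t}{\Delta x},$$ so $q=\nu\Delta tK_h=s\,(\sum_\xi\eta_\xi^2)^{1/2}$ and $0\le q^2\le\frac{49d}{9}s^2$. The $d$-dimensional CFL threshold of a coefficient $a$ is the supremum of the $s>0$ for which $q=q(\kappa)$ lies in the contiguous spectral stability interval $[0,Q(a)]$ for all $\kappa\in\mathbb{R}^d$. By convention, the practical stability condition is the strict inequality requiring $s$ to be smaller than the threshold (at the threshold itself the amplification matrix of the extremal nonzero mode may be defective). *)

(* Defs.v *)
From HB Require Import structures.
From mathcomp Require Import all_boot all_order all_algebra.
From mathcomp Require Import all_classical all_reals all_analysis.
Set Implicit Arguments.
Unset Strict Implicit.
Unset Printing Implicit Defensive.
Import Order.TTheory GRing.Theory Num.Theory numFieldNormedType.Exports.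
Local Open Scope classical_set_scope.
Local Open Scope ring_scope.

Definition expmx (R : realType) (n : nat) (X : 'M[R]_n.+1) : 'M[R]_n.+1 :=
  limn (series (fun k : nat => (k`!%:R)^-1 *: X ^+ k)).

(* C and D act on the column vector (h, e)^T: index 0 is the magnetic and
   index 1 the electric component. *)
Definition electric_part (R : realType) (nu K : R) : 'M[R]_2 :=
  (nu * K) *: delta_mx 1 0.

Definition magnetic_part (R : realType) (nu K : R) : 'M[R]_2 :=
  (nu * K) *: - delta_mx 0 1.

Definition step_matrix (R : realType) (a nu dt K : R) : 'M[R]_2 :=
  let C := electric_part nu K in
  let D := magnetic_part nu K in
  expmx ((a * dt) *: C) *m expmx ((2^-1 * dt) *: D)
    *m expmx (((1 - 2 * a) * dt) *: C)
    *m expmx ((2^-1 * dt) *: D) *m expmx ((a * dt) *: C).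

Definition g2 (R : realType) (a : R) : R := a * (1 - 2 * a) / 2.

Definition diag_entry (R : realType) (a q : R) : R :=
  1 - q ^+ 2 / 2 + g2 a / 2 * q ^+ 4.

Definition spectrally_stable (R : realType) (a q : R) : Prop :=
  `|diag_entry a q| <= 1.

(* The supremum is taken in the extended reals, where it exists for every a
   without a boundedness proof. *)
Definition stab_length (R : realType) (a : R) : \bar R :=
  ereal_sup [set Q%:E | Q in
    [set Q : R | 0 <= Q /\
                 forall q : R, 0 <= q -> q <= Q -> spectrally_stable a q]].

Definition maximizes_stab_length (R : realType) (a : R) : Prop :=
  forall b : R, (stab_length b <= stab_length a)%E.

Definition eta (R : realType) (dx k : R) : R :=
  (27 * sin (k * dx / 2) - sin (3 * k * dx / 2)) / 12.

Definition Kh (R : realType) (d : nat) (dx : R) (kappa : 'rV[R]_d) : R :=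
  Num.sqrt ((dx ^+ 2)^-1 * \sum_(xi < d) eta dx (kappa 0 xi) ^+ 2).

(* q = nu dt K_h, with nu dt = s dx *)
Definition mode_q (R : realType) (d : nat) (dx s : R) (kappa : 'rV[R]_d) : R :=
  s * dx * Kh dx kappa.

Definition cfl_threshold (R : realType) (d : nat) (dx a : R) : \bar R :=
  ereal_sup [set s%:E | s in
    [set s : R | 0 < s /\
       forall kappa : 'rV[R]_d,
         0 <= mode_q dx s kappa /\
         ((mode_q dx s kappa)%:E <= stab_length a)%E]].

(* The inequality is strict because at the threshold the amplification matrix
   of the extremal mode may be defective. *)
Definition practically_stable (R : realType) (d : nat) (nu dt dx a : R) : Prop :=
  ((nu * dt / dx)%:E < cfl_threshold d dx a)%E.

(* Main.v *)
(** Put x = q^2 and g = g_2(a); stability at q reads 0 <= x (1 - g x) <= 4.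
    At x = 8 the upper bound forces g >= 1/16, which is the maximum of
    a (1 - 2 a) / 2, attained only at a = 1/4: every other a has Q(a) <= sqrt 8.
    For g = 1/16 the upper bound is (x - 8)^2 >= 0 and the lower one is x <= 16,
    so Q(1/4) = 4.  With u = sin (k dx / 2) the stencil symbol is
    eta = (6 u + u^3) / 3, so |eta| <= 7/3 with equality at k = pi / dx. *)
Require Import Defs.
From HB Require Import structures.
From mathcomp Require Import all_boot all_order all_algebra.
From mathcomp Require Import all_classical all_reals all_analysis.
From mathcomp Require Import ring lra.
Import Order.TTheory GRing.Theory Num.Theory numFieldNormedType.Exports.
Local Open Scope ring_scope.

Section StepMatrix.
Variable R : realType.
Implicit Types (a nu dt K q x : R).

(** All terms of the exponential series from [X ^+ 2] on vanish, so its partial sums with at least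
    two terms are constant. *)
Lemma expmx_nilpotent2 n (X : 'M[R]_n.+1) : X * X = 0 -> expmx X = 1 + X.
Proof.
move=> XX0; apply: cvg_lim; first exact: norm_hausdorff.
apply: cvg_near_cst; exists 2%N => //= -[|[|m]] // _.
rewrite /series /= big_nat_recl // big_nat_recl // expr0 expr1 fact0 factS fact0.
rewrite invr1 !scale1r big1 ?addr0 // => i _.
by rewrite !exprS mulrA XX0 mul0r scaler0.
Qed.

Lemma expmx_scale_delta x (i j : 'I_2) :
  i != j -> expmx (x *: delta_mx i j) = 1 + x *: delta_mx i j.
Proof.
move=> ij; apply: expmx_nilpotent2.
rewrite -scalerAl -scalerAr -[_ * _]/(_ *m _) mul_delta_mx_cond.
by rewrite eq_sym (negbTE ij) !scaler0.
Qed.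

(** Both generators are multiples of an off-diagonal unit matrix, so the five exponentials are
    shears and their product is polynomial in [nu * dt * K]. *)
Lemma step_matrix_diag a nu dt K (i : 'I_2) :
  step_matrix a nu dt K i i = diag_entry a (nu * dt * K).
Proof.
have magneticE : magnetic_part nu K = (- (nu * K)) *: delta_mx 0 1.
  by rewrite /magnetic_part scalerN scaleNr.
rewrite /step_matrix /electric_part magneticE !scalerA.
rewrite !expmx_scale_delta //.
rewrite /diag_entry /g2 !mxE !big_ord_recl !big_ord0 !mxE !big_ord_recl !big_ord0.
rewrite !mxE !big_ord_recl !big_ord0 !mxE !big_ord_recl !big_ord0 !mxE.
by case: i => -[|[|//]] ? /=; field.
Qed.

End StepMatrix.

Section StabilityInterval.
Variable R : realType.
Implicit Types (a q Q : R).

Lemma spectrally_stableE a q : spectrally_stable a q <->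
  0 <= q ^+ 2 * (1 - g2 a * q ^+ 2) <= 4.
Proof.
rewrite /spectrally_stable /diag_entry ler_norml.
have -> : q ^+ 4 = q ^+ 2 * q ^+ 2 by rewrite -exprD.
by split=> /andP[? ?]; apply/andP; split; lra.
Qed.

Lemma g2_quarter : g2 4^-1 = 16^-1 :> R.
Proof. by rewrite /g2; field. Qed.

Lemma stable_quarterE q : spectrally_stable 4^-1 q <-> q ^+ 2 <= 16.
Proof.
rewrite spectrally_stableE g2_quarter.
move: (q ^+ 2) (sqr_ge0 q) => x x0; split=> [/andP[h _]|x16].
  rewrite leNgt; apply/negP => x16.
  by have : 0 < x * (x - 16); [rewrite mulr_gt0 //; lra | lra].
have : 0 <= x * (16 - x) by rewrite mulr_ge0 //; lra.
(* The gap in the upper bound is a square: 4 - x (1 - x / 16) = (x - 8)^2 / 16. *)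
by have := sqr_ge0 (x - 8); move=> ? ?; apply/andP; split; lra.
Qed.

Lemma stable_sqrt8 a : spectrally_stable a (Num.sqrt 8) -> a = 4^-1.
Proof.
rewrite spectrally_stableE sqr_sqrtr // /g2 => /andP[_ h].
(* Since 1/16 - g_2(a) = (a - 1/4)^2, the bound [h] says that this square is at most 0. *)
apply/eqP; rewrite -subr_eq0 -sqrf_eq0 eq_le sqr_ge0 andbT.
by lra.
Qed.

Lemma stab_length_quarter : stab_length (4^-1 : R) = 4%:E.
Proof.
apply/eqP; rewrite eq_le; apply/andP; split.
  apply: ge_ereal_sup => _ [Q [Q0 /(_ Q Q0 (lexx _))/stable_quarterE h] <-].
  by rewrite lee_fin -(ler_pXn2r (ltn0Sn 1)) ?nnegrE //; lra.
apply: ereal_sup_ubound; exists 4 => //; split => // q q0 q4.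
by apply/stable_quarterE; nra.
Qed.

(** A stability interval reaching beyond sqrt 8 would contain sqrt 8 itself, where only a = 1/4 is
    stable. *)
Lemma stab_length_le_sqrt8 a :
  a != 4^-1 -> (stab_length a <= (Num.sqrt 8)%:E)%E.
Proof.
move=> aN; apply: ge_ereal_sup => _ [Q [Q0 stQ] <-]; rewrite lee_fin leNgt.
apply/negP => /ltW Q8; move/eqP: aN; apply.
by apply/stable_sqrt8/stQ => //; exact: sqrtr_ge0.
Qed.

Lemma sqrt8_lt4 : Num.sqrt 8 < 4 :> R.
Proof.
by rewrite -(ltr_pXn2r (ltn0Sn 1)) ?nnegrE ?sqrtr_ge0 // sqr_sqrtr //; lra.
Qed.

(** The gap sqrt 8 < 4 gives both the maximality of 1/4 and its uniqueness. *)
Lemma maximizes_stab_lengthE a : maximizes_stab_length a <-> a = 4^-1.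
Proof.
split=> [/(_ 4^-1)|-> b].
  rewrite stab_length_quarter => h; apply/eqP; apply: contraT.
  move=> /stab_length_le_sqrt8 /(le_trans h); rewrite lee_fin.
  by rewrite leNgt sqrt8_lt4.
have [->//|/stab_length_le_sqrt8 h] := eqVneq b 4^-1.
by rewrite stab_length_quarter (le_trans h)// lee_fin ltW// sqrt8_lt4.
Qed.

End StabilityInterval.

Section Stencil.
Variable R : realType.
Implicit Types (dx s k t : R).

Lemma sin_triple t : sin (3 * t) = 3 * sin t - 4 * sin t ^+ 3.
Proof.
have -> : 3 * t = t + t + t by ring.
rewrite !(sinD, cosD).
transitivity (3 * sin t * cos t ^+ 2 - sin t ^+ 3); first by ring.
by rewrite cos2sin2; ring.
Qed.

Lemma etaE dx k : Defs.eta dx k = (6 * sin (k * dx / 2) + sin (k * dx / 2) ^+ 3) / 3.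
Proof.
by rewrite /Defs.eta -!mulrA sin_triple; field.
Qed.

Lemma eta_sqr_le dx k : Defs.eta dx k ^+ 2 <= 49 / 9.
Proof.
rewrite etaE; set u := sin _.
have : u ^+ 2 <= 1 by rewrite -(cos2Dsin2 (k * dx / 2)) lerDr sqr_ge0.
have -> : ((6 * u + u ^+ 3) / 3) ^+ 2 = u ^+ 2 * (6 + u ^+ 2) ^+ 2 / 9 by field.
(* On [0, 1] the function x (6 + x)^2 / 9 increases to its value 49/9 at x = 1. *)
move: (u ^+ 2) (sqr_ge0 u) => x x0 x1; nra.
Qed.

Lemma eta_nyquist dx : dx != 0 -> Defs.eta dx (pi / dx) = 7 / 3.
Proof.
move=> dx0; rewrite etaE divfK // sin_pihalf; by field.
Qed.

(** The mesh width in [s * dx] cancels the factor 1 / dx in [Kh]; only the symbols [eta] still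
    involve [dx]. *)
Lemma mode_qE d dx s (kappa : 'rV[R]_d) : 0 < dx ->
  mode_q dx s kappa = s * Num.sqrt (\sum_(xi < d) Defs.eta dx (kappa 0 xi) ^+ 2).
Proof.
move=> dx0; rewrite /mode_q /Kh sqrtrM ?invr_ge0 ?sqr_ge0 //.
by rewrite sqrtrV ?sqr_ge0 // sqrtr_sqr gtr0_norm // -mulrA mulVKf ?gt_eqF.
Qed.

Lemma sqrt_sum_eta_le d dx (kappa : 'rV[R]_d) :
  Num.sqrt (\sum_(xi < d) Defs.eta dx (kappa 0 xi) ^+ 2) <= 7 / 3 * Num.sqrt d%:R.
Proof.
have -> : 7 / 3 * Num.sqrt d%:R = Num.sqrt (49 / 9 * d%:R) :> R.
  rewrite sqrtrM //; congr (_ * _).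
  have -> : 49 / 9 = (7 / 3) ^+ 2 :> R by field.
  by rewrite sqrtr_sqr ger0_norm.
rewrite ler_sqrt ?mulr_ge0 //.
have -> : 49 / 9 * d%:R = \sum_(xi < d) (49 / 9) :> R.
  by rewrite sumr_const card_ord mulr_natr.
by apply: ler_sum => i _; exact: eta_sqr_le.
Qed.

(** The Nyquist wave number in every direction makes all symbols extremal at once, so the preceding
    bound is sharp. *)
Lemma sqrt_sum_eta_nyquist d dx : dx != 0 ->
  Num.sqrt (\sum_(xi < d) Defs.eta dx ((const_mx (pi / dx) : 'rV[R]_d) 0 xi) ^+ 2)
    = 7 / 3 * Num.sqrt d%:R.
Proof.
move=> dx0; under eq_bigr => i _ do rewrite mxE eta_nyquist //.
rewrite sumr_const card_ord -[X in Num.sqrt X]mulr_natr.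
by rewrite sqrtrM ?sqr_ge0 // sqrtr_sqr ger0_norm.
Qed.

Lemma cfl_threshold_quarter d dx : (1 <= d)%N -> 0 < dx ->
  cfl_threshold d dx 4^-1 = (12 / (7 * Num.sqrt d%:R))%:E.
Proof.
move=> d1 dx0.
have sd0 : 0 < Num.sqrt d%:R :> R by rewrite sqrtr_gt0 ltr0n.
apply/eqP; rewrite eq_le; apply/andP; split.
  (* Upper bound: the Nyquist mode has q = (7/3) s sqrt d, which must not exceed 4. *)
  apply: ge_ereal_sup => _ [s [s0 /(_ (const_mx (pi / dx)))[_ +]] <-].
  rewrite stab_length_quarter mode_qE // sqrt_sum_eta_nyquist ?gt_eqF //.
  by rewrite !lee_fin ler_pdivlMr ?mulr_gt0 //; lra.
(* Lower bound: the threshold is itself admissible, because the largest q it produces is exactly 4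
   and the stability interval is closed. *)
apply: ereal_sup_ubound; exists (12 / (7 * Num.sqrt d%:R)) => //.
have s0 : 0 < 12 / (7 * Num.sqrt d%:R) :> R by rewrite divr_gt0 ?mulr_gt0.
split=> // kappa; rewrite stab_length_quarter mode_qE //; split.
  by rewrite mulr_ge0 ?sqrtr_ge0 // ltW.
rewrite lee_fin (le_trans (ler_wpM2l (ltW s0) (sqrt_sum_eta_le d dx kappa))) //.
rewrite le_eqVlt; apply/orP; left; apply/eqP; field; exact: lt0r_neq0.
Qed.

End Stencil.

Theorem theorem3p2 (R : realType) :
  (forall (a nu dt K : R), 0 < nu -> 0 < dt -> forall i : 'I_2,
     step_matrix a nu dt K i i = diag_entry a (nu * dt * K)) /\
  (forall a : R,
     maximizes_stab_length a <-> a = 4^-1 /\ 1 - 2 * a = 2^-1) /\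
  (forall q : R, 0 <= q ^+ 2 <= 16 -> spectrally_stable 4^-1 q) /\
  (forall (d : nat) (dx : R), (1 <= d)%N -> 0 < dx ->
     cfl_threshold d dx 4^-1 = (12 / (7 * Num.sqrt d%:R))%:E /\
     forall nu dt : R, 0 < nu -> 0 < dt ->
       (practically_stable d nu dt dx 4^-1 <->
        nu * dt / dx < 12 / (7 * Num.sqrt d%:R))).
Proof.
split; first by move=> *; exact: step_matrix_diag.
split.
  move=> a; rewrite maximizes_stab_lengthE; split=> [->|[]//].
  by split=> //; field.
split; first by move=> q /andP[_ /stable_quarterE].
move=> d dx d1 dx0; split; first exact: cfl_threshold_quarter.
by move=> nu dt _ _; rewrite /practically_stable cfl_threshold_quarter // lte_fin.
Qed.
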